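(* Let $\nu\in\mathbb{R}\setminus\{0,-1,-2,\dots\}$ and $x\in(0,1)$. Then $$\lim_{n\to\infty}\frac{\#\{\mu\in\sigma(L_{n}(\nu)) \mid 4x<\mu<4\}}{\log n}=\frac{1}{2\pi}\sqrt{\frac{1-x}{x}}.$$
   Context: For $n\in\mathbb{N}=\{1,2,\dots\}$ and $\nu\in\mathbb{R}\setminus\{0,-1,-2,\dots\}$, $L_{n}(\nu)$ denotes the $n\times n$ real symmetric matrix with entries $(L_{n}(\nu))_{i,j}=\dfrac{1}{\max(i,j)+\nu}$ for $i,j=0,1,\dots,n-1$. $\sigma(M)$ is the set of eigenvalues of the matrix $M$, and $\#S$ is the cardinality of the set $S$. *)

(* Defs.v *)
From mathcomp Require Import all_boot all_order all_algebra finmap.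
From mathcomp Require Import all_classical all_reals all_analysis.

Set Implicit Arguments.
Unset Strict Implicit.
Unset Printing Implicit Defensive.

Import Order.TTheory GRing.Theory Num.Theory.
Import numFieldNormedType.Exports.

Local Open Scope classical_set_scope.
Local Open Scope ring_scope.

Definition Lmatrix (R : realType) (n : nat) (nu : R) : 'M[R]_n :=
  \matrix_(i < n, j < n) ((maxn i j)%:R + nu)^-1.

(* The spectrum in [R]; nothing is lost for a real symmetric matrix, whose
   complex eigenvalues are all real. *)
Definition spectrum (R : realType) (n : nat) (M : 'M[R]_n) : set R :=
  [set mu | eigenvalue M mu].

(* [fset_set] sends an infinite set to the empty one; this lemma ensures that
   the default value is never used on a subset of a spectrum. *)
Lemma finite_spectrum (R : realType) (n : nat) (M : 'M[R]_n) :
  finite_set (spectrum M).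
Proof.
have fin_roots k (p : {poly R}) : (size p <= k)%N -> p != 0 ->
    finite_set [set a | root p a].
  elim: k p => [|k IH] p; first by rewrite leqn0 size_poly_eq0 => ->.
  move=> pk p0; have [[a pa]|nroot] := pselect (exists a, root p a); last first.
    suff -> : [set a | root p a] = set0 by [].
    by apply/seteqP; split=> // a pa; case: nroot; exists a.
  have [q pE] := factor_theorem p a pa.
  have q0 : q != 0 by apply: contraNneq p0 => q0; rewrite pE q0 mul0r.
  apply: (@sub_finite_set _ _ (a |` [set b | root q b])).
    move=> b /=; rewrite pE rootM root_XsubC => /orP[|/eqP ->]; [by right|by left].
  rewrite finite_setU; split=> //; apply: IH => //.
  by move: pk; rewrite pE size_Mmonic ?monicXsubC// size_XsubC addn2.
rewrite (_ : spectrum M = [set a | root (char_poly M) a]); last first.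
  by apply/seteqP; split=> a /=; rewrite /spectrum /= eigenvalue_root_char.
by apply: (fin_roots _ _ (leqnn _)); rewrite monic_neq0 ?char_poly_monic.
Qed.

(* Main.v *)
Require Import Defs.
From mathcomp Require Import all_boot all_order all_algebra finmap.
From mathcomp Require Import complex.
From mathcomp Require Import all_classical all_reals all_analysis.
From mathcomp Require Import ring lra zify.

Set Implicit Arguments.
Unset Strict Implicit.
Unset Printing Implicit Defensive.

Import Order.TTheory GRing.Theory Num.Theory.
Import numFieldNormedType.Exports.

Local Open Scope classical_set_scope.
Local Open Scope ring_scope.

(** Write [a k = 1 / (k + nu)] and let [T k] be the sum of the first [k]
    coordinates of a vector [u], with [T n = 0].  Since the entry [(i, j)] of
    the matrix is [a (max i j)], summation by parts turns the quadratic form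
    [u L u^T] into the sum of the [(a k - a (k+1)) T(k+1)^2], while [u u^T] is
    the sum of the [(T(k+1) - T k)^2].  As [a k - a (k+1)] is close to
    [1 / k^2], comparing [L] with [t = 1 / lambda] is comparing the discrete
    Dirichlet energy of [T] with [lambda] times a Hardy weight.  The matching
    differential equation [T'' = - lambda T / s^2] has, for
    [lambda = 1/4 + w^2], the solutions [sqrt s * cos (w * ln s - c)], whose
    nodes are equally spaced by [pi / w] in the variable [ln s].  So one
    eigenvalue above [t] is expected for each interval of length [pi / w] in
    [[0, ln n]], that is about [w / pi * ln n] of them; for [t = 4 x] this is
    the claimed constant.

    To make this exact, the wave [sqrt k * (cos (w * ln k - c) + b)] is used
    with a small constant [b]: it is a strict discrete subsolution when
    [b > 0] and a strict supersolution when [b < 0], uniformly in the phase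
    [c], as soon as [k] is large ([wave_defect]).  The integers are cut into
    blocks on which [ln k] varies by [l].

    - If [l] is slightly larger than [pi / w], the positive parts of the waves
      with [b > 0] centred on the blocks span a space on which [L > t]
      ([Lmatrix_eigencount_lower]).
    - If [l] is slightly smaller than [pi / w], the waves with [b < 0] are
      positive on their blocks, and a discrete Picone inequality shows that
      [L <= t] on the space of the vectors for which [T] vanishes at the end
      of every block and at the first few indices
      ([Lmatrix_eigencount_upper]).

    Both bounds are turned into eigenvalue counts by the min-max principle
    ([eigenvalue_count_ge], [eigenvalue_count_le]).  Distinct eigenvalues are
    counted, and all of them are simple because an eigenvector is determined
    by its first coordinate ([Lmatrix_simple]).  Finally the eigenvalues
    [>= 4] are negligible: their number is at most that of the eigenvalues
    above [1 / (1/4 + w'^2)], of order [w' / pi * ln n] with [w'] arbitrarily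
    small. *)

(** * Orthonormal eigenbases of real symmetric matrices *)

(** The spectral theorem over the complex extension gives a complex base change
    to a real diagonal matrix; similar real matrices are similar over the reals. *)
Lemma symmetric_diagonalizable (R : rcfType) (n : nat) (A : 'M[R]_n) :
  A^T = A ->
  exists P : 'M[R]_n, exists2 D : 'rV[R]_n, P \in unitmx & P *m A = diag_mx D *m P.
Proof.
move=> symA.
pose toC := real_complex R.
pose AC : 'M[R[i]]_n := map_mx toC A.
have toC_real (x : R) : toC x \is Num.real by apply/complex_realP; exists x.
have ACreal : AC \is a mxOver Num.real.
  by apply/mxOverP => i j; rewrite mxE.
have ACsym : AC \is symmetricmx.
  by apply/is_hermitianmxP; rewrite expr0 scale1r map_mx_id // /AC map_trmx symA.
have ACherm := realsym_hermsym ACsym ACreal.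
have /orthomx_spectralP ACE := hermitian_normalmx ACherm.
have Dreal := hermitian_spectral_diag_real ACherm.
set P := spectralmx AC in ACE.
set D := spectral_diag AC in ACE Dreal.
have Punit : P \in unitmx by apply: spectral_unit.
have sim : similar P AC (diag_mx D).
  by apply/similarP => //; rewrite ACE !mulmxA mulmxV // mul1mx.
have diagDreal : diag_mx D \is a mxOver Num.real.
  apply/mxOverP => i j; rewrite mxE; case: (i == j) => /=.
    by rewrite mulr1n (mxOverP _ _).
  by rewrite mulr0n real0.
have [Q] := real_similar (ex_intro2 _ _ P Punit sim) ACreal diagDreal.
rewrite inE => /andP[/= Qreal Qunit] /(similarP Qunit) QE.
have liftE m k (B : 'M[R[i]]_(m, k)) : B \is a mxOver Num.real ->
    B = map_mx toC (map_mx (@complex.Re R) B).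
  move=> Breal; apply/matrixP => i j; rewrite !mxE.
  by rewrite /toC RRe_real // (mxOverP _ _).
exists (map_mx (@complex.Re R) Q), (map_mx (@complex.Re R) D).
  by rewrite -(map_unitmx toC) -liftE.
apply: (@map_mx_inj _ _ toC).
by rewrite !map_mxM /= map_diag_mx -!liftE.
Qed.

(** The standard inner product of two row vectors. *)
Definition rdot (R : pzRingType) (n : nat) (u v : 'rV[R]_n) : R := (u *m v^T) 0 0.

Lemma rdotE (R : pzRingType) (n : nat) (u v : 'rV[R]_n) :
  rdot u v = \sum_i u 0 i * v 0 i.
Proof. by rewrite /rdot mxE; apply: eq_bigr => i _; rewrite mxE. Qed.

Lemma rdot_gt0 (R : realDomainType) (n : nat) (u : 'rV[R]_n) :
  u != 0 -> 0 < rdot u u.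
Proof.
move=> u0; rewrite rdotE lt_neqAle sumr_ge0 ?andbT; last first.
  by move=> i _; rewrite -expr2 sqr_ge0.
apply: contraNneq u0 => /esym/eqP; rewrite psumr_eq0; last first.
  by move=> i _; rewrite -expr2 sqr_ge0.
move=> /allP h; apply/eqP/rowP => i; rewrite mxE.
by have := h i (mem_index_enum _); rewrite mulf_eq0 orbb => /eqP.
Qed.

(** The second hypothesis says that an eigenvector is determined by its first
    coordinate, so that every eigenspace is a line.  The rows of [E] form an
    orthonormal basis of eigenvectors, with pairwise distinct eigenvalues. *)
Lemma simple_symmetric_eigenbasis (R : rcfType) (n : nat) (A : 'M[R]_n) :
  A^T = A ->
  (forall (a : R) (v : 'rV[R]_n), v *m A = a *: v ->
     (forall i : 'I_n, i = 0 :> nat -> v 0 i = 0) -> v = 0) ->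
  exists E : 'M[R]_n, exists2 mu : 'rV[R]_n,
    injective (mu 0) & E *m E^T = 1%:M /\ E *m A = diag_mx mu *m E.
Proof.
move=> symA simpleA.
have [P [D Pu PA]] := symmetric_diagonalizable symA.
have rowP0 i : row i P != 0.
  apply/eqP => ri0; have : (delta_mx 0 i : 'rV[R]_n) *m P = 0 by rewrite -rowE.
  move=> /(congr1 (mulmx^~ (invmx P))); rewrite mulmxK // mul0mx => /rowP/(_ i).
  by rewrite !mxE !eqxx /= => /eqP; rewrite oner_eq0.
have rowPA i : row i P *m A = D 0 i *: row i P.
  by rewrite -row_mul PA row_mul row_diag_mx -scalemxAl -rowE.
have Dinj : injective (D 0).
  move=> i j Dij; apply/eqP/negPn/negP => nij.
  have n0 : (0 < n)%N by apply: leq_ltn_trans (ltn_ord i).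
  pose o := Ordinal n0.
  pose v := P j o *: row i P - P i o *: row j P.
  (* a combination of two eigenvectors whose first coordinate vanishes *)
  have v0 : v = 0.
    apply: (simpleA (D 0 i)).
      rewrite mulmxBl -!scalemxAl !rowPA -Dij scalerBr !scalerA.
      by congr (_ *: _ - _ *: _); rewrite mulrC.
    move=> k k0; have -> : k = o by apply: val_inj.
    by rewrite !mxE mulrC subrr.
  have : (P j o *: delta_mx 0 i - P i o *: delta_mx 0 j : 'rV[R]_n) *m P = 0.
    by rewrite mulmxBl -!scalemxAl -!rowE.
  move=> /(congr1 (mulmx^~ (invmx P))); rewrite mulmxK // mul0mx => h.
  have Pj0 : P j o = 0.
    have /rowP/(_ i) := h.
    by rewrite !mxE !eqxx (negPf nij) /= mulr1 mulr0 subr0.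
  have /eqP[] := rowP0 j.
  apply: (simpleA (D 0 j)) => // k k0; have -> : k = o by apply: val_inj.
  by rewrite mxE.
have orth i j : i != j -> rdot (row i P) (row j P) = 0.
  move=> nij; have : D 0 i * rdot (row i P) (row j P) = D 0 j * rdot (row i P) (row j P).
    have -> : D 0 i * rdot (row i P) (row j P) = (row i P *m A *m (row j P)^T) 0 0.
      by rewrite rowPA -scalemxAl [RHS]mxE.
    rewrite -mulmxA -{1}symA -trmx_mul rowPA linearZ /= -scalemxAr [LHS]mxE.
    by [].
  move/eqP; rewrite -subr_eq0 -mulrBl mulf_eq0 subr_eq0 => /orP[|/eqP//].
  by move=> /eqP/Dinj ij; rewrite ij eqxx in nij.
pose c i := (Num.sqrt (rdot (row i P) (row i P)))^-1.
pose E : 'M[R]_n := \matrix_i (c i *: row i P).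
exists E, D => //; split.
  apply/matrixP => i j; rewrite !mxE.
  have -> : \sum_k E i k * E^T k j = c i * c j * rdot (row i P) (row j P).
    rewrite rdotE mulr_sumr; apply: eq_bigr => k _; rewrite !mxE; ring.
  have [<-|nij] := eqVneq i j; last by rewrite orth // mulr0.
  have gt0 := rdot_gt0 (rowP0 i).
  rewrite /c -invfM -expr2 sqr_sqrtr ?ltW // mulVf // gt_eqF //.
apply/row_matrixP => i.
rewrite !row_mul row_diag_mx rowK -!scalemxAl rowPA -rowE rowK.
by rewrite !scalerA mulrC.
Qed.

(** * Eigenvalue counts and the min-max principle *)

Lemma wide_mulmx_eq0 (F : fieldType) (p q : nat) (M : 'M[F]_(p, q)) :
  (q < p)%N -> exists2 c : 'rV[F]_p, c != 0 & c *m M = 0.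
Proof.
move=> qp; have : kermx M != 0.
  rewrite -mxrank_eq0 mxrank_ker subn_eq0 -ltnNge.
  exact: leq_ltn_trans (rank_leq_col _) qp.
move=> /rowV0Pn[c /sub_kermxP cM c0]; by exists c.
Qed.

Lemma eigenbasis_form (R : realFieldType) (n : nat) (A E : 'M[R]_n) (mu y : 'rV[R]_n) :
  E *m E^T = 1%:M -> E *m A = diag_mx mu *m E ->
  rdot (y *m E *m A) (y *m E) = \sum_i mu 0 i * y 0 i ^+ 2
  /\ rdot (y *m E) (y *m E) = \sum_i y 0 i ^+ 2.
Proof.
move=> EE EA; split.
  rewrite /rdot -(mulmxA y) EA trmx_mul !mulmxA -(mulmxA _ E) EE mulmx1.
  rewrite mul_mx_diag !mxE; apply: eq_bigr => i _; rewrite !mxE; ring.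
rewrite /rdot trmx_mul !mulmxA -(mulmxA _ E) EE mulmx1 !mxE.
by apply: eq_bigr => i _; rewrite !mxE.
Qed.

Lemma spectrum_eigenbasis (R : realType) (n : nat) (A E : 'M[R]_n) (mu : 'rV[R]_n) :
  E *m E^T = 1%:M -> E *m A = diag_mx mu *m E ->
  spectrum A = range (mu 0).
Proof.
move=> EE EA; have EtE := mulmx1C EE; apply/seteqP; split=> [a|_ [i _ <-]]; last first.
  apply/eigenvalueP; exists (row i E).
    by rewrite -row_mul EA row_mul row_diag_mx -scalemxAl -rowE.
  apply/eqP => ri0; have : (delta_mx 0 i : 'rV[R]_n) *m E = 0 by rewrite -rowE.
  move=> /(congr1 (mulmx^~ E^T)); rewrite -mulmxA EE mulmx1 mul0mx => /rowP/(_ i).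
  by rewrite !mxE !eqxx /= => /eqP; rewrite oner_eq0.
move=> /eigenvalueP[v vA v0].
have yE : (v *m E^T) *m E = v by rewrite -mulmxA EtE mulmx1.
have y0 : v *m E^T != 0 by apply: contraNneq v0 => y0; rewrite -yE y0 mul0mx.
have : exists i, (v *m E^T) 0 i != 0.
  apply/existsP; apply: contraNT y0 => /existsPn h; apply/eqP/rowP => i.
  by rewrite [RHS]mxE; apply/eqP/negPn.
move=> [i yi]; exists i => //; apply: (mulIf yi).
have : (v *m E^T) *m diag_mx mu = a *: (v *m E^T).
  have /(congr1 (mulmx^~ E^T)) := EA.
  rewrite -(mulmxA (diag_mx mu)) EE mulmx1 => <-.
  by rewrite !mulmxA yE vA -scalemxAl.
by rewrite mul_mx_diag => /rowP/(_ i); rewrite [LHS]mxE [RHS]mxE mulrC.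
Qed.

(** If the form of [A] is at most [t] on the common kernel of [m] linear
    functionals, the columns of [F], then at most [m] eigenvalues exceed [t]:
    otherwise the span of their eigenvectors would meet that kernel. *)
Lemma eigenvalue_count_le (R : realFieldType) (n m : nat) (A E : 'M[R]_n)
    (mu : 'rV[R]_n) (t : R) (F : 'M[R]_(n, m)) :
  E *m E^T = 1%:M -> E *m A = diag_mx mu *m E ->
  (forall w : 'rV[R]_n, w *m F = 0 -> rdot (w *m A) w <= t * rdot w w) ->
  (#|[set i | (t < mu 0 i)%R]%SET| <= m)%N.
Proof.
move=> EE EA hF; set I := [set i | (t < mu 0 i)%R]%SET; rewrite leqNgt; apply/negP => mI.
(* the rows of [J *m E] are the eigenvectors with eigenvalue above [t] *)
pose J := rowsub (enum_val : 'I_#|I| -> 'I_n) (1%:M : 'M[R]_n).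
have [c c0 cJ] := wide_mulmx_eq0 (J *m E *m F) mI.
pose y := c *m J.
have yF : y *m E *m F = 0 by rewrite /y -!mulmxA !mulmxA -(mulmxA c) -(mulmxA c).
have yJ i : y 0 (enum_val i) = c 0 i.
  rewrite /y mxE (bigD1 i) //= !mxE eqxx mulr1 big1 ?addr0 // => j ji.
  by rewrite !mxE (inj_eq enum_val_inj) (negPf ji) mulr0.
have yN i : i \notin I -> y 0 i = 0.
  move=> iI; rewrite mxE big1 // => j _; rewrite !mxE.
  have [ij|_] := eqVneq (enum_val j) i; last by rewrite mulr0.
  by rewrite -ij enum_valP in iI.
have [fA fE] := eigenbasis_form y EE EA.
have := hF _ yF; rewrite fA fE mulr_sumr; apply/negP; rewrite -ltNge.
have [i ci] : exists i, c 0 i != 0.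
  apply/existsP; apply: contraNT c0 => /existsPn h; apply/eqP/rowP => i.
  by rewrite [RHS]mxE; apply/eqP/negPn.
rewrite -subr_gt0 -sumrB.
have ge k : 0 <= mu 0 k * y 0 k ^+ 2 - t * y 0 k ^+ 2.
  rewrite -mulrBl; have [kI|kI] := boolP (k \in I).
    by rewrite mulr_ge0 ?sqr_ge0 // subr_ge0 ltW //; rewrite inE in kI.
  by rewrite yN // expr0n mulr0.
rewrite (bigD1 (enum_val i)) //= ltr_pwDl ?sumr_ge0 //.
rewrite -mulrBl yJ mulr_gt0 // ?exprn_even_gt0 // subr_gt0.
by have := enum_valP i; rewrite inE.
Qed.

(** If the form of [A] exceeds [t] on the image of an [m]-dimensional space,
    then at least [m] eigenvalues exceed [t]: otherwise that image would contain
    the image of a nonzero vector orthogonal to all their eigenvectors. *)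
Lemma eigenvalue_count_ge (R : realFieldType) (n m : nat) (A E : 'M[R]_n)
    (mu : 'rV[R]_n) (t : R) (V : 'M[R]_(m, n)) :
  E *m E^T = 1%:M -> E *m A = diag_mx mu *m E ->
  (forall c : 'rV[R]_m, c != 0 ->
     t * rdot (c *m V) (c *m V) < rdot (c *m V *m A) (c *m V)) ->
  (m <= #|[set i | (t < mu 0 i)%R]%SET|)%N.
Proof.
move=> EE EA hV; have EtE := mulmx1C EE.
set I := [set i | (t < mu 0 i)%R]%SET; rewrite leqNgt; apply/negP => mI.
(* multiplying by [E^T *m J] takes the coordinates along the eigenvectors with
   eigenvalue above [t] *)
pose J := colsub (enum_val : 'I_#|I| -> 'I_n) (1%:M : 'M[R]_n).
have [c c0 cJ] := wide_mulmx_eq0 (V *m E^T *m J) mI.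
pose y := c *m V *m E^T.
have yE : y *m E = c *m V by rewrite /y -mulmxA EtE mulmx1.
have yI i : i \in I -> y 0 i = 0.
  move=> iI; have : y *m J = 0 by rewrite /y -!mulmxA !mulmxA -(mulmxA c) -(mulmxA c).
  move=> /rowP/(_ (enum_rank_in iI i)); rewrite [LHS]mxE [RHS]mxE => <-.
  rewrite (bigD1 i) //= [J i _]mxE [1%:M _ _]mxE enum_rankK_in // eqxx mulr1.
  rewrite big1 ?addr0 // => j ji.
  by rewrite [J j _]mxE [1%:M _ _]mxE enum_rankK_in // (negPf ji) mulr0.
have [fA fE] := eigenbasis_form y EE EA.
have := hV c c0; rewrite -yE fA fE mulr_sumr; apply/negP; rewrite -leNgt.
apply: ler_sum => i _; have [iI|iI] := boolP (i \in I).
  by rewrite yI // expr0n !mulr0.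
by rewrite ler_wpM2r ?sqr_ge0 // leNgt; rewrite inE in iI.
Qed.

(** * The quadratic form of the L-matrix and its simple spectrum *)

(** The sum of the first [k] coordinates of [w]. *)
Definition psum (R : nmodType) (n : nat) (w : 'rV[R]_n) (k : nat) : R :=
  \sum_(i < n | (i < k)%N) w 0 i.

Lemma psum0 (R : nmodType) (n : nat) (w : 'rV[R]_n) : psum w 0 = 0.
Proof. by rewrite /psum big_pred0. Qed.

Lemma psumS (R : zmodType) (n : nat) (w : 'rV[R]_n) (k : 'I_n) :
  psum w k.+1 - psum w k = w 0 k.
Proof.
rewrite /psum (bigD1 k) //= -addrA [X in _ + X](_ : _ = 0) ?addr0 //.
apply/eqP; rewrite subr_eq0; apply/eqP/eq_bigl => i.
by rewrite ltnS [RHS]ltn_neqAle andbC.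
Qed.

(** Abel summation for a kernel that only depends on the maximum of the indices,
    applied to the increments of [T]. *)
Lemma max_kernel_form (R : comPzRingType) (a T : nat -> R) (n : nat) : T 0%N = 0 ->
  \sum_(i < n) \sum_(j < n)
     a (maxn i j) * (T i.+1 - T i) * (T j.+1 - T j)
  = \sum_(k < n) (a k - a k.+1) * T k.+1 ^+ 2 + a n * T n ^+ 2.
Proof.
move=> T0; elim: n => [|n IH]; first by rewrite !big_ord0 T0; ring.
have telescope : \sum_(j < n) (T j.+1 - T j) = T n.
  by rewrite -(big_mkord xpredT (fun j => T j.+1 - T j)) telescope_sumr // T0 subr0.
under eq_bigr => i _ do rewrite big_ord_recr /=.
rewrite big_split /= [X in X + _]big_ord_recr /= IH.
rewrite [X in _ + X + _](_ : _ = a n * (T n.+1 - T n) * T n); last first.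
  rewrite -[X in _ = _ * X]telescope mulr_sumr; apply: eq_bigr => j _.
  have -> : maxn n j = n by apply/maxn_idPl/ltnW.
  by [].
rewrite [X in _ + X = _](_ : _ = a n * (T n.+1 - T n) * T n.+1); last first.
  transitivity (a n * (T n.+1 - T n) * (T n + (T n.+1 - T n))); last by ring.
  rewrite big_ord_recr /= maxnn [RHS]mulrDr; congr (_ + _).
  rewrite -[X in _ = _ * X]telescope mulr_sumr; apply: eq_bigr => j _.
  have -> : maxn j n = n by apply/maxn_idPr/ltnW.
  ring.
rewrite big_ord_recr /=; ring.
Qed.

Lemma Lmatrix_sym (R : realType) (n : nat) (nu : R) : (Lmatrix n nu)^T = Lmatrix n nu.
Proof. by apply/matrixP => i j; rewrite !mxE maxnC. Qed.

Lemma Lmatrix_form (R : realType) (n : nat) (nu : R) (w : 'rV[R]_n) :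
  let a k := (k%:R + nu)^-1 in
  psum w n = 0 ->
  rdot (w *m Lmatrix n nu) w = \sum_(k < n) (a k - a k.+1) * psum w k.+1 ^+ 2.
Proof.
move=> a wn; have := max_kernel_form a n (psum0 w); rewrite wn expr0n mulr0 addr0 => <-.
rewrite rdotE; apply: eq_bigr => i _.
rewrite mxE mulr_suml; apply: eq_bigr => j _.
rewrite !psumS mxE maxnC /a; ring.
Qed.

Lemma rdot_psum (R : pzRingType) (n : nat) (w : 'rV[R]_n) :
  rdot w w = \sum_(k < n) (psum w k.+1 - psum w k) ^+ 2.
Proof. by rewrite rdotE; apply: eq_bigr => k _; rewrite psumS. Qed.

(** With [b k = 1 / (k + nu)], subtracting consecutive equations of [v L = a v]
    gives [(b k - b (k+1)) * psum v (k+1) = a * (v k - v (k+1))].  When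
    [a != 0], this recurrence determines [v] from its first coordinate; when
    [a = 0], it makes the partial sums vanish, the last equation taking care of
    the total sum. *)
Lemma Lmatrix_simple (R : realType) (n : nat) (nu : R) :
  (forall k : nat, nu != - k%:R) ->
  forall (a : R) (v : 'rV[R]_n), v *m Lmatrix n nu = a *: v ->
    (forall i : 'I_n, i = 0 :> nat -> v 0 i = 0) -> v = 0.
Proof.
move=> hnu a v vL v0.
have nu0 k : k%:R + nu != 0 by rewrite addrC addr_eq0 hnu.
pose b k := (k%:R + nu)^-1.
have bS k : b k - b k.+1 != 0.
  rewrite subr_eq0 (inj_eq invr_inj) (inj_eq (addIr _)) eqr_nat; lia.
have step (k k1 : 'I_n) : k1 = k.+1 :> nat ->
    (b k - b k.+1) * psum v k.+1 = a * (v 0 k - v 0 k1).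
  move=> kk1.
  have -> : a * (v 0 k - v 0 k1) = (v *m Lmatrix n nu) 0 k - (v *m Lmatrix n nu) 0 k1.
    rewrite vL !mxE; ring.
  rewrite !mxE -sumrB /psum mulr_sumr big_mkcond /=; apply: eq_bigr => i _.
  rewrite !mxE kk1 -mulrBr; case: ifP => ik.
    have -> : maxn i k = k by apply/maxn_idPr; lia.
    have -> : maxn i k.+1 = k.+1 by apply/maxn_idPr; lia.
    by rewrite mulrC.
  have -> : maxn i k = i by apply/maxn_idPl; lia.
  have -> : maxn i k.+1 = i by apply/maxn_idPl; lia.
  by rewrite subrr mulr0.
have [a0|a0] := eqVneq a 0.
  have psv (k : 'I_n) : psum v k.+1 = 0.
    have [kn|kn] := ltnP k.+1 n.
      have /eqP := step k (Ordinal kn) erefl.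
      by rewrite a0 mul0r mulf_eq0 (negPf (bS k)) /= => /eqP.
    have := congr1 (fun M : 'rV_n => M 0 k) vL; rewrite a0 scale0r !mxE.
    have -> : \sum_j v 0 j * Lmatrix n nu j k = b k * psum v k.+1.
      rewrite /psum mulr_sumr [RHS]big_mkcond /=; apply: eq_bigr => i _.
      have ik : (i < k.+1)%N by have := ltn_ord i; lia.
      by rewrite ik mxE (maxn_idPr _) 1?mulrC.
    by move=> /eqP; rewrite mulf_eq0 invr_eq0 (negPf (nu0 k)) /= => /eqP.
  apply/rowP => k; rewrite mxE -psumS psv sub0r; apply/eqP; rewrite oppr_eq0.
  case: k => [[|k] kn] /=; first by rewrite psum0.
  by rewrite (psv (Ordinal (ltnW kn))).
suff main k : forall i : 'I_n, (i <= k)%N -> v 0 i = 0.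
  by apply/rowP => i; rewrite mxE (main i).
elim: k => [|k IH] i ik; first by apply: v0; lia.
have [|ki] := leqP i k; first exact: IH.
have kn : (k < n)%N by have := ltn_ord i; lia.
have := step (Ordinal kn) i; rewrite (_ : psum v _ = 0); last first.
  by rewrite /psum big1 // => j; rewrite ltnS => /IH.
rewrite (IH (Ordinal kn)) // mulr0 sub0r => /(_ _) /esym /eqP.
by rewrite mulf_eq0 (negPf a0) oppr_eq0 /= => h; apply/eqP/h => /=; lia.
Qed.

Lemma Lmatrix_eigenbasis (R : realType) (n : nat) (nu : R) :
  (forall k : nat, nu != - k%:R) ->
  exists E : 'M[R]_n, exists2 mu : 'rV[R]_n,
    injective (mu 0) &
    E *m E^T = 1%:M /\ E *m Lmatrix n nu = diag_mx mu *m E.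
Proof.
move=> hnu; apply: simple_symmetric_eigenbasis; first exact: Lmatrix_sym.
exact: Lmatrix_simple.
Qed.

(** The number of distinct eigenvalues of [A] that satisfy [P]. *)
Definition eigencount (R : realType) (n : nat) (A : 'M[R]_n) (P : pred R) : nat :=
  #|` fset_set [set mu | spectrum A mu /\ P mu]|.

Lemma eigencountE (R : realType) (n : nat) (A E : 'M[R]_n) (mu : 'rV[R]_n) (P : pred R) :
  injective (mu 0) -> E *m E^T = 1%:M -> E *m A = diag_mx mu *m E ->
  eigencount A P = #|[set i | P (mu 0 i)]%SET|.
Proof.
move=> mui EE EA; rewrite /eigencount (spectrum_eigenbasis EE EA).
set I := [set i | P (mu 0 i)]%SET.
have -> : [set m | range (mu 0) m /\ P m] = [set` [fset x in [seq mu 0 i | i <- enum I]]%fset].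
  apply/seteqP; split=> [_ [[i _ <-] Pi]|m] /=.
    by rewrite inE /=; apply/mapP; exists i => //; rewrite mem_enum inE.
  rewrite inE /= => /mapP[k]; rewrite mem_enum inE => Pk ->.
  by split; [exists k|].
rewrite set_fsetK card_fseq undup_id ?size_map -?cardE //.
by rewrite map_inj_uniq ?enum_uniq.
Qed.

(** * Counting the eigenvalues of the L-matrix by test sequences *)

(** Upper bound by [#|Z|], where the partial sums [T] are constrained to vanish
    at the indices [i + 1], for [i] in [Z]; the total sum [T n] is among them. *)
Lemma Lmatrix_count_le (R : realType) (n : nat) (nu t : R) (Z : {set 'I_n}) :
  (forall k : nat, nu != - k%:R) ->
  (forall i : 'I_n, i.+1 = n -> i \in Z) ->
  (forall T : nat -> R, T 0%N = 0 -> (forall i, i \in Z -> T i.+1 = 0) ->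
     \sum_(k < n) ((k%:R + nu)^-1 - (k.+1%:R + nu)^-1) * T k.+1 ^+ 2
     <= t * \sum_(k < n) (T k.+1 - T k) ^+ 2) ->
  (eigencount (Lmatrix n nu) (fun mu => (t < mu)%R) <= #|Z|)%N.
Proof.
move=> hnu nZ hT; have [E [mu mui [EE EA]]] := Lmatrix_eigenbasis n hnu.
rewrite (eigencountE _ mui EE EA).
pose F : 'M[R]_(n, #|Z|) := \matrix_(i, z) (i < (enum_val z : 'I_n).+1)%N%:R.
apply: (eigenvalue_count_le (F := F) EE EA) => w wF.
have wZ i : i \in Z -> psum w i.+1 = 0.
  move=> iZ; have /rowP/(_ (enum_rank_in iZ i)) := wF.
  rewrite [LHS]mxE [RHS]mxE => <-; rewrite /psum big_mkcond /=.
  apply: eq_bigr => j _; rewrite mxE enum_rankK_in //.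
  by case: ifP; rewrite ?mulr1 ?mulr0.
have wn : psum w n = 0.
  case: n => [|n] in w Z nZ hT E mu mui EE EA F wF wZ *; first exact: psum0.
  exact: (wZ ord_max (nZ ord_max erefl)).
rewrite Lmatrix_form // rdot_psum; apply: hT => //; exact: psum0.
Qed.

Lemma psum_diff (R : zmodType) (n : nat) (T : nat -> R) (k : nat) :
  T 0%N = 0 -> (k <= n)%N -> psum (\row_(i < n) (T i.+1 - T i)) k = T k.
Proof.
move=> T0; elim: k => [|k IH] kn; first by rewrite psum0 T0.
have := psumS (\row_(i < n) (T i.+1 - T i)) (Ordinal kn).
by rewrite mxE /= IH 1?ltnW // => /addIr.
Qed.

(** Lower bound by [m], for test sequences of partial sums that are the
    combinations of [m] given sequences vanishing at [0] and [n]. *)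
Lemma Lmatrix_count_ge (R : realType) (n m : nat) (nu t : R) (phi : 'I_m -> nat -> R) :
  (forall k : nat, nu != - k%:R) ->
  (forall j, phi j 0%N = 0) -> (forall j, phi j n = 0) ->
  (forall c : 'rV[R]_m, c != 0 ->
     let T k := \sum_j c 0 j * phi j k in
     t * \sum_(k < n) (T k.+1 - T k) ^+ 2 <
     \sum_(k < n) ((k%:R + nu)^-1 - (k.+1%:R + nu)^-1) * T k.+1 ^+ 2) ->
  (m <= eigencount (Lmatrix n nu) (fun mu => (t < mu)%R))%N.
Proof.
move=> hnu phi0 phin hphi; have [E [mu mui [EE EA]]] := Lmatrix_eigenbasis n hnu.
rewrite (eigencountE _ mui EE EA).
pose V : 'M[R]_(m, n) := \matrix_(j, i) (phi j i.+1 - phi j i).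
apply: (eigenvalue_count_ge (V := V) EE EA) => c c0.
pose T k := \sum_j c 0 j * phi j k.
have T0 : T 0%N = 0 by rewrite /T big1 // => j _; rewrite phi0 mulr0.
have Tn : T n = 0 by rewrite /T big1 // => j _; rewrite phin mulr0.
have cV : c *m V = \row_(i < n) (T i.+1 - T i).
  apply/rowP => i; rewrite !mxE /T -sumrB; apply: eq_bigr => j _.
  by rewrite mxE mulrBr.
rewrite Lmatrix_form cV ?psum_diff // rdot_psum.
under eq_bigr => k _.
  rewrite (psum_diff T0 (ltn_ord k)) (psum_diff T0 (ltnW (ltn_ord k))); over.
under [ltRHS]eq_bigr => k _.
  rewrite (psum_diff T0 (ltn_ord k)); over.
exact: hphi.
Qed.

(** * Second differences of square-root waves *)

Lemma is_derive_local_bound (R : realType) (f : R -> R) (s eta : R) :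
  is_derive (0 : R) (1 : R) f s -> 0 < eta ->
  exists2 d : R, 0 < d & forall c, `|c| < d -> `|f c - f 0 - s * c| <= eta * `|c|.
Proof.
move=> [df Df] eta0; have := df; rewrite /derivable => /cvgrPdist_le /(_ _ eta0).
rewrite -/(derive _ _ _) Df => /nbhs_ballP[d /= d0 hd]; exists d => // c cd.
have [->|c0] := eqVneq c 0; first by rewrite normr0 !mulr0 subr0 subrr normr0.
have := hd c; rewrite /ball /= sub0r normrN => /(_ cd c0).
rewrite addr0 [c%:A]mulr1 => h.
have -> : f c - f 0 - s * c = - (c * (s - c^-1 *: (f c - f 0))).
  by rewrite /GRing.scale /= mulrBr mulrA divff // mul1r; ring.
by rewrite normrN normrM mulrC ler_wpM2r.
Qed.

(** Second order Taylor formula for the symmetric second difference at [0],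
    requiring the second derivative only at [0]. *)
Lemma symmetric_second_difference (R : realType) (F dF : R -> R) (s eta : R) :
  (forall e : R, `|e| < 1 -> is_derive e (1 : R) F (dF e)) ->
  is_derive (0 : R) (1 : R) dF s -> 0 < eta ->
  exists2 d : R, 0 < d & forall e, 0 < e < d ->
    `|F e + F (- e) - 2 * F 0 - s * e ^+ 2| <= eta * e ^+ 2.
Proof.
move=> hF hdF eta0.
have [d0 d0p hd] := is_derive_local_bound hdF (divr_gt0 eta0 (ltr0Sn R 1)).
exists (Num.min d0 1); first by rewrite lt_min d0p ltr01.
move=> e /andP[e0]; rewrite lt_min => /andP[ed e1].
pose H t := F t + F (- t) - s * t ^+ 2.
have HD t : `|t| < 1 -> is_derive t (1 : R) H (dF t - dF (- t) - 2 * s * t).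
  move=> t1; have FP := hF t t1.
  have FN : is_derive (- t) (1 : R) F (dF (- t)) by apply: hF; rewrite normrN.
  rewrite /H; apply: is_derive_eq.
  rewrite /GRing.scale /=; ring.
have Hc : {within `[0, e], continuous H}.
  apply: derivable_within_continuous => t; rewrite in_itv /= => /andP[t0 te].
  have t1 : `|t| < 1 by rewrite ger0_norm // (le_lt_trans te).
  by have [] := HD t t1.
have [|c /[!in_itv] /= /andP[c0 ce] HE] := MVT e0 _ Hc (df := fun t => dF t - dF (- t) - 2 * s * t).
  move=> t; rewrite in_itv /= => /andP[t0 te]; apply: HD.
  by rewrite ger0_norm ?ltW // (lt_trans te).
have -> : F e + F (- e) - 2 * F 0 - s * e ^+ 2 = H e - H 0.
  by rewrite /H oppr0; ring.
rewrite HE subr0 normrM (gtr0_norm e0) expr2 mulrA ler_wpM2r ?(ltW e0) //.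
have cd : `|c| < d0 by rewrite gtr0_norm // (lt_trans ce).
have h1 := hd c cd; have h2 := hd (- c); rewrite normrN in h2; have {}h2 := h2 cd.
rewrite (gtr0_norm c0) in h1 h2.
have -> : dF c - dF (- c) - 2 * s * c =
  (dF c - dF 0 - s * c) - (dF (- c) - dF 0 - s * (- c)) by ring.
apply: (le_trans (ler_normB _ _)); apply: (le_trans (lerD h1 h2)).
rewrite -mulrDl -splitr ler_wpM2l // ltW //.
Qed.

Section oscillation.
Variables (R : realType) (w : R).
Implicit Types A B e : R.

(** The value at [s = 1 + e] of the solution
    [sqrt s * (A cos (w ln s) + B sin (w ln s))] of [f'' = - (1/4 + w^2) f / s^2];
    the square root is written as an exponential. *)
Definition osc A B e : R := expR (ln (1 + e) / 2) *
  (A * cos (w * ln (1 + e)) + B * sin (w * ln (1 + e))).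

(** The derivative of [osc], where [exp (ln (1 + e) / 2) / (1 + e)] is written
    as [exp (- ln (1 + e) / 2)]. *)
Definition dosc A B e : R := expR (- ln (1 + e) / 2) *
  ((A / 2 + w * B) * cos (w * ln (1 + e)) + (B / 2 - w * A) * sin (w * ln (1 + e))).

Lemma is_derive_ln1D e : `|e| < 1 ->
  is_derive e (1 : R) (fun e => ln (1 + e)) (expR (- ln (1 + e))).
Proof.
rewrite ltr_norml => /andP[e1 e2].
have p : 0 < 1 + e by lra.
have := is_derive1_ln p => h.
apply: is_derive_eq.
by rewrite add0r expRN lnK // [LHS]mulr1.
Qed.

Lemma is_derive_osc A B e : `|e| < 1 -> is_derive e (1 : R) (osc A B) (dosc A B e).
Proof.
move=> e1; have h := is_derive_ln1D e1; rewrite /osc.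
apply: is_derive_eq.
rewrite /dosc /GRing.scale /=.
set q := ln (1 + e).
have -> : expR (- q / 2) = expR (q / 2) * expR (- q) by rewrite -expRD; congr expR; field.
ring.
Qed.

Lemma is_derive_dosc0 A B : is_derive (0 : R) (1 : R) (dosc A B) (- (4^-1 + w ^+ 2) * A).
Proof.
have h : is_derive (0 : R) (1 : R) (fun e => ln (1 + e)) (expR (- ln (1 + 0))).
  by apply: is_derive_ln1D; rewrite normr0.
rewrite /dosc; apply: is_derive_eq.
rewrite /GRing.scale /= addr0 ln1 mulr0 oppr0 mul0r expR0 cos0 sin0.
by field.
Qed.

Lemma osc_second_difference A B eta : 0 < eta ->
  exists2 d : R, 0 < d & forall e, 0 < e < d ->
    `|osc A B e + osc A B (- e) - 2 * A + (4^-1 + w ^+ 2) * A * e ^+ 2| <= eta * e ^+ 2.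
Proof.
move=> eta0.
have [d d0 hd] := symmetric_second_difference (is_derive_osc A B) (is_derive_dosc0 A B) eta0.
exists d => // e /hd.
rewrite {3}/osc addr0 ln1 mulr0 mul0r expR0 cos0 sin0 mul1r mulr0 addr0 mulr1.
by rewrite !mulNr opprK.
Qed.

End oscillation.

(** With [e = 1 / (k + 1)], this says that [1 / (k + nu) - 1 / (k + 1 + nu)] is
    equivalent to [1 / (k + 1)^2]. *)
Lemma Lmatrix_weight_asymp (R : realType) (nu eta : R) : 0 < eta ->
  exists2 d : R, 0 < d & forall e, 0 < e < d ->
    `|(e^-1 - 1 + nu)^-1 - (e^-1 + nu)^-1 - e ^+ 2| <= eta * e ^+ 2.
Proof.
move=> eta0.
pose p e := (1 + (nu - 1) * e) * (1 + nu * e).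
have pc : {for 0, continuous p}.
  apply: cvgM; apply: cvgD; try exact: cvg_cst; apply: cvgM; try exact: cvg_cst; exact: cvg_id.
have p0 : p 0 = 1 by rewrite /p !mulr0 addr0 mulr1.
have fc : (p e)^-1 @[e --> 0] --> (1 : R).
  by rewrite -[X in _ --> X]invr1 -p0; apply: cvgV => //; rewrite p0 oner_neq0.
have /cvgrPdist_le /(_ _ eta0) /nbhs_ballP[d1 /= d10 hd1] := fc.
have /cvgrPdist_lt /(_ _ ltr01) /nbhs_ballP[d2 /= d20 hd2] := pc.
exists (Num.min d1 d2); first by rewrite lt_min d10.
move=> e /andP[e0]; rewrite lt_min => /andP[ed1 ed2].
have := hd1 e; rewrite /ball /= sub0r normrN gtr0_norm // => /(_ ed1) h1.
have := hd2 e; rewrite /ball /= sub0r normrN gtr0_norm // => /(_ ed2) h2.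
have pe0 : p e != 0.
  by apply: contraTneq h2 => ->; rewrite p0 subr0 normr1 ltxx.
have -> : (e^-1 - 1 + nu)^-1 - (e^-1 + nu)^-1 - e ^+ 2 = - (e ^+ 2 * (1 - (p e)^-1)).
  move: pe0; rewrite /p mulf_eq0 negb_or => /andP[n1 n2].
  have en0 : e != 0 by rewrite gt_eqF.
  have -> : e^-1 - 1 + nu = (1 + (nu - 1) * e) / e by field.
  have -> : e^-1 + nu = (1 + nu * e) / e by field.
  field. by rewrite n1 n2.
by rewrite normrN normrM ger0_norm ?sqr_ge0 // mulrC ler_wpM2r ?sqr_ge0.
Qed.

(** The comparison sequence [sqrt k * (cos (w ln k - c) + b)], with [sqrt k]
    written as an exponential. *)
Definition wave (R : realType) (w c b : R) (k : nat) : R :=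
  expR (ln k%:R / 2) * (cos (w * ln k%:R - c) + b).

Lemma wave_shift (R : realType) (w c b x e : R) : 0 < x -> 0 < 1 + e ->
  expR (ln (x * (1 + e)) / 2) * (cos (w * ln (x * (1 + e)) - c) + b) =
  expR (ln x / 2) * (cos (w * ln x - c) * osc w 1 0 e - sin (w * ln x - c) * osc w 0 1 e
     + b * osc 0 1 0 e).
Proof.
move=> x0 e0; rewrite lnM ?posrE // mulrDl expRD (mulrDr w).
have -> : w * ln x + w * ln (1 + e) - c = (w * ln x - c) + w * ln (1 + e) by ring.
rewrite cosD /osc !mul0r cos0; ring.
Qed.

(** The wave solves the eigenvalue equation up to the source
    [- b * w^2 * (k+1)^(-3/2)] and an error of smaller order, which is uniform
    in the phase [c] because the addition formulas reduce it to the functions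
    [osc]. *)
Lemma wave_defect (R : realType) (w nu eta : R) : 0 < eta ->
  exists2 K : nat, (0 < K)%N & forall k c b, (K <= k)%N -> `|b| <= 1 ->
    let r := expR (ln k.+1%:R / 2) / k.+1%:R ^+ 2 in
    `|2 * wave w c b k.+1 - wave w c b k - wave w c b k.+2
      - (4^-1 + w ^+ 2) * ((k%:R + nu)^-1 - (k.+1%:R + nu)^-1) * wave w c b k.+1
      + b * w ^+ 2 * r| <= eta * r.
Proof.
move=> eta0; set lam := 4^-1 + w ^+ 2.
have lam0 : 0 < lam by rewrite ltr_pwDl ?sqr_ge0 // invr_gt0.
have [h h0 hE] : exists2 h, 0 < h & h * (3 + 2 * lam) = eta.
  exists (eta / (3 + 2 * lam)); first by rewrite divr_gt0 // addr_gt0 // mulr_gt0.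
  by rewrite divfK // gt_eqF // addr_gt0 // mulr_gt0.
have [d1 d10 H1] := osc_second_difference w 1 0 h0.
have [d2 d20 H2] := osc_second_difference w 0 1 h0.
have [d3 d30 H3] := osc_second_difference 0 1 0 h0.
have [d4 d40 H4] := Lmatrix_weight_asymp nu h0.
pose d := Num.min (Num.min d1 d2) (Num.min d3 d4).
have d0 : 0 < d by rewrite !lt_min d10 d20 d30.
exists (Num.truncn d^-1).+1 => // k c b Kk b1.
set x : R := k.+1%:R; pose e := x^-1.
have k0 : (0 < k)%N by apply: leq_trans Kk.
have x0 : 0 < x by rewrite ltr0n.
have e0 : 0 < e by rewrite invr_gt0.
have xe : x * e = 1 by rewrite divff ?gt_eqF.
have ed : e < d.
  rewrite /e invf_plt ?posrE //; apply: (lt_trans (truncnS_gt _)).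
  by rewrite ltr_nat ltnS.
move: (ed); rewrite !lt_min => /andP[/andP[ed1 ed2] /andP[ed3 ed4]].
have := H1 e; rewrite e0 ed1 => /(_ isT); set C := osc w 1 0 e + _ => B1.
have := H2 e; rewrite e0 ed2 => /(_ isT); set S := osc w 0 1 e + _ => B2.
have := H3 e; rewrite e0 ed3 => /(_ isT); set D := osc 0 1 0 e + _ => B3.
have := H4 e; rewrite e0 ed4 => /(_ isT).
have kx : k%:R = x - 1 by rewrite /x -natr1 addrK.
have k2x : k.+2%:R = x * (1 + e) by rewrite mulrDr xe mulr1 /x -natr1.
have kx' : k%:R = x * (1 - e) by rewrite mulrBr xe mulr1 kx.
have e1 : 0 < 1 - e by rewrite -(pmulr_rgt0 _ x0) -kx' ltr0n.
rewrite {1 2}/e invrK -kx; set ek := _^-1 - _ => B4; set r := _ / _; cbv zeta.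
have rE : r = expR (ln x / 2) * e ^+ 2 by rewrite /r /e exprVn.
have W1 : wave w c b k.+1 = expR (ln x / 2) * (cos (w * ln x - c) + b) by [].
have W0 : wave w c b k = expR (ln x / 2) * (cos (w * ln x - c) * osc w 1 0 (- e)
    - sin (w * ln x - c) * osc w 0 1 (- e) + b * osc 0 1 0 (- e)).
  by rewrite -wave_shift // -kx'.
have W2 : wave w c b k.+2 = expR (ln x / 2) * (cos (w * ln x - c) * osc w 1 0 e
    - sin (w * ln x - c) * osc w 0 1 e + b * osc 0 1 0 e).
  by rewrite -wave_shift ?addr_gt0 // -k2x.
rewrite {}W0 {}W1 {}W2 {}rE; move: r => _.
set th := w * ln x - c; set s := expR (ln x / 2).
have s0 : 0 < s by apply: expR_gt0.
pose z := - cos th * (C - 2 * 1 + lam * 1 * e ^+ 2) + sin th * (S - 2 * 0 + lam * 0 * e ^+ 2)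
  - b * (D - 2 * 1 + (4^-1 + 0 ^+ 2) * 1 * e ^+ 2) - lam * (cos th + b) * (ek - e ^+ 2).
rewrite [X in `|X|](_ : _ = s * z); last first.
  rewrite /z /C /S /D /lam. ring.
rewrite normrM gtr0_norm // mulrCA ler_pM2l //.
have -> : eta * e ^+ 2 = h * e ^+ 2 + h * e ^+ 2 + h * e ^+ 2 + lam * 2 * (h * e ^+ 2).
  by rewrite -hE; ring.
have mul1 (u v m : R) : `|u| <= 1 -> `|v| <= m -> `|u * v| <= m.
  move=> u1 vm; rewrite normrM -[m]mul1r ler_pM //.
apply: (le_trans (ler_normB _ _)); apply: lerD; last first.
  rewrite !normrM (gtr0_norm lam0) -!mulrA ler_pM2l //; apply: ler_pM => //.
  by apply: (le_trans (ler_normD _ _)); rewrite -[2]/(1+1) lerD // cos_max.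
apply: (le_trans (ler_normB _ _)); apply: lerD; last exact: mul1.
apply: (le_trans (ler_normD _ _)); apply: lerD; apply: mul1 => //.
  by rewrite normrN cos_max.
exact: sin_max.
Qed.

(** * Comparison waves and logarithmic blocks *)

Section comparison.
Variables (R : realType) (w nu b : R).
Hypotheses (w0 : 0 < w) (b0 : 0 < b) (b1 : b <= 1).

Lemma wave_subsolution : exists K : nat, forall k c, (K <= k)%N ->
  2 * wave w c b k.+1 - wave w c b k - wave w c b k.+2 <
  (4^-1 + w ^+ 2) * ((k%:R + nu)^-1 - (k.+1%:R + nu)^-1) * wave w c b k.+1.
Proof.
have eta0 : 0 < b * w ^+ 2 / 2 by rewrite divr_gt0 // mulr_gt0 // exprn_gt0.
have [K _ hK] := wave_defect w nu eta0; exists K => k c Kk.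
have bn : `|b| <= 1 by rewrite gtr0_norm.
have := hK k c b Kk bn; cbv zeta; set r := expR _ / _.
have r0 : 0 < r by rewrite divr_gt0 ?expR_gt0 // exprn_gt0 // ltr0n.
rewrite ler_norml => /andP[_ h].
have {}r0 : 0 < b * w ^+ 2 * r by rewrite mulr_gt0 // mulr_gt0 // exprn_gt0.
set X := _ * _ * wave _ _ _ _ in h *; set Y := 2 * _ - _ - _ in h *.
have {}h : Y - X + b * w ^+ 2 * r <= b * w ^+ 2 * r / 2 by rewrite [leRHS]mulrAC.
by lra.
Qed.

Lemma wave_supersolution : exists K : nat, forall k c, (K <= k)%N ->
  (4^-1 + w ^+ 2) * ((k%:R + nu)^-1 - (k.+1%:R + nu)^-1) * wave w c (- b) k.+1 <
  2 * wave w c (- b) k.+1 - wave w c (- b) k - wave w c (- b) k.+2.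
Proof.
have eta0 : 0 < b * w ^+ 2 / 2 by rewrite divr_gt0 // mulr_gt0 // exprn_gt0.
have [K _ hK] := wave_defect w nu eta0; exists K => k c Kk.
have bn : `|- b| <= 1 by rewrite normrN gtr0_norm.
have := hK k c (- b) Kk bn; cbv zeta; set r := expR _ / _.
have r0 : 0 < r by rewrite divr_gt0 ?expR_gt0 // exprn_gt0 // ltr0n.
rewrite ler_norml => /andP[h _].
have {}r0 : 0 < b * w ^+ 2 * r by rewrite mulr_gt0 // mulr_gt0 // exprn_gt0.
set X := _ * _ * wave _ _ _ _ in h *; set Y := 2 * _ - _ - _ in h *.
have {}h : - (b * w ^+ 2 * r / 2) <= Y - X - b * w ^+ 2 * r.
  have -> : b * w ^+ 2 * r / 2 = b * w ^+ 2 / 2 * r by rewrite mulrAC.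
  by move: h; rewrite !mulNr.
by lra.
Qed.

End comparison.

Section blocks.
Variables (R : realType) (l : R).
Hypothesis l0 : 0 < l.

(** The index [j] of the block [[exp (j l), exp ((j + 1) l))] that contains [k];
    [0] is put in the block [0]. *)
Definition block (k : nat) : nat := Num.truncn (ln (k%:R : R) / l).

(** The phase [c] that centres the wave of frequency [w] on the block [j]. *)
Definition phase (w : R) (j : nat) : R := w * ((j%:R + 2^-1) * l).

Lemma ln_nat_ge0 k : 0 <= ln (k%:R : R).
Proof. by case: k => [|k]; [rewrite ln0|rewrite ln_ge0 // ler1n]. Qed.

Lemma block_homo k k' : (k <= k')%N -> (block k <= block k')%N.
Proof.
move=> kk; apply: le_truncn; rewrite ler_pM2r ?invr_gt0 //.
case: k kk => [|k] kk; first by rewrite ln0 ?ln_nat_ge0.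
by rewrite ler_ln ?posrE ?ltr0n ?ler_nat //; lia.
Qed.

Lemma block_lt k k' : (block k < block k')%N -> (k < k')%N.
Proof. by apply: contraTT; rewrite -!leqNgt; apply: block_homo. Qed.

Lemma block0 : block 0 = 0%N.
Proof. by rewrite /block ln0 // mul0r truncn0. Qed.

Lemma phase_le w k : 0 < w -> `|w * ln k%:R - phase w (block k)| <= w * l / 2.
Proof.
move=> w0; rewrite /phase -mulrBr normrM gtr0_norm // -mulrA ler_pM2l //.
have /andP[h1 h2] := truncn_itv (divr_ge0 (ln_nat_ge0 k) (ltW l0)).
rewrite -/(block k) -natr1 in h1 h2.
rewrite ler_pdivlMr // in h1; rewrite ltr_pdivrMr // in h2.
by rewrite ler_norml; apply/andP; split; lra.
Qed.

Lemma phase_block w k j : 0 < w -> `|w * ln k%:R - phase w j| < w * l / 2 -> block k = j.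
Proof.
move=> w0; rewrite /phase -mulrBr normrM gtr0_norm // -mulrA ltr_pM2l //.
rewrite ltr_norml => /andP[h1 h2]; apply: truncn_def.
by rewrite -natr1 ler_pdivlMr // ltr_pdivrMr //; apply/andP; split; lra.
Qed.

End blocks.

(** The argument of the wave moves by less than [g] from a large index to the
    next. *)
Lemma phase_step (R : realType) (w g : R) : 0 < w -> 0 < g -> exists2 K : nat, (0 < K)%N &
  forall (k : nat) (c : R), (K <= k)%N -> `|(w * ln k.+1%:R - c) - (w * ln k%:R - c)| < g.
Proof.
move=> w0 g0; exists (Num.truncn (w / g)).+1 => // k c Kk.
have k0 : 0 < k%:R :> R by rewrite ltr0n (leq_trans _ Kk).
have -> : w * ln k.+1%:R - c - (w * ln k%:R - c) = w * ln (1 + k%:R^-1).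
  have -> : 1 + k%:R^-1 = k.+1%:R / k%:R :> R by rewrite -natr1 mulrDl divff ?gt_eqF // mul1r.
  by rewrite ln_div ?posrE ?ltr0n //; [ring|rewrite -(ltr0n R)].
have k1 : 0 <= k%:R^-1 :> R by rewrite invr_ge0 ltW.
rewrite ger0_norm; last by apply: mulr_ge0; [exact: ltW|rewrite ln_ge0 // lerDl].
apply: (@le_lt_trans _ _ (w * k%:R^-1)).
  by rewrite ler_pM2l // le_ln1Dx // (lt_le_trans _ k1).
rewrite ltr_pdivrMr // mulrC -ltr_pdivrMr //; apply: (lt_le_trans (truncnS_gt _)).
by rewrite ler_nat.
Qed.

(** * Lower bound for the number of eigenvalues *)

Lemma cos_le_of_norm_le (R : realType) (x a : R) : `|x| <= a -> a <= pi -> cos a <= cos x.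
Proof.
move=> xa api; rewrite -(cos_norm x) leNgt; apply/negP.
rewrite ltr_cos ?in_itv /= ?normr_ge0 ?api ?(le_trans xa) ?andbT //.
  by rewrite ltNge xa.
exact: le_trans xa.
Qed.

Lemma summation_by_parts (R : comPzRingType) (T : nat -> R) (n : nat) :
  T 0%N = 0 -> T n = 0 ->
  \sum_(k < n) (T k.+1 - T k) ^+ 2
  = \sum_(k < n) T k.+1 * (2 * T k.+1 - T k - T k.+2).
Proof.
move=> T0 Tn.
suff -> : \sum_(k < n) (T k.+1 - T k) ^+ 2
    = \sum_(k < n) T k.+1 * (2 * T k.+1 - T k - T k.+2)
      + T 0%N ^+ 2 - T 0%N * T 1%N - T n ^+ 2 + T n * T n.+1 by rewrite T0 Tn; ring.
elim: n {Tn} => [|n IH]; first by rewrite !big_ord0; ring.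
rewrite !big_ord_recr /= IH; ring.
Qed.

Section lower.
Variables (R : realType) (w nu l : R).
Hypotheses (hnu : forall k : nat, nu != - k%:R).
Hypotheses (w0 : 0 < w) (lpi : pi < w * l) (l2pi : w * l <= 2 * pi).

(** One eigenvalue above [1 / (1/4 + w^2)] for each block of logarithmic length
    [l > pi / w], up to a bounded number of exceptions.  The bound
    [l <= 2 * pi / w] keeps the argument of the wave of a block in
    [[-pi, pi]]. *)
Lemma Lmatrix_eigencount_lower :
  exists C : nat, forall n : nat, (block l n <=
    eigencount (Lmatrix n nu) (fun mu => ((4^-1 + w ^+ 2)^-1 < mu)%R) + C)%N.
Proof.
have pi0 := pi_gt0 R.
have l0 : 0 < l by rewrite -(pmulr_rgt0 _ w0) (lt_trans _ lpi).
(* [a] is the half-width of a block for the argument of the wave *)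
have [a [a' [aE aa api [a'lo a'a aa']]]] : exists a a', [/\ a = w * l / 2, pi / 2 < a,
    a <= pi & [/\ pi / 2 < a', a' < a & a - a' < a']].
  exists (w * l / 2), ((w * l / 2 + pi / 2) / 2).
  by move: lpi l2pi pi0; move: (w * l) (pi : R) => x p *; split => //; [|lra|split]; lra.
pose b := - cos a'.
(* for arguments in [[-pi, pi]], [cos + b] is positive exactly between [-a'] and [a'] *)
have b0 : 0 < b.
  by rewrite /b oppr_gt0 -(@cos_pihalf R) ltr_cos ?in_itv //=; apply/andP; split; lra.
have b1 : b <= 1 by rewrite /b lerNl cos_geN1.
have [K1 sub] := wave_subsolution nu w0 b0 b1.
have g0 : 0 < a - a' by rewrite subr_gt0.
have [K2 K20 step] := phase_step w0 g0.
have [K [K1K K2K]] : exists K, (K1 <= K)%N /\ (K2 <= K)%N.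
  by exists (maxn K1 K2); rewrite leq_maxl leq_maxr.
have [j0 j0E] : exists j0, j0 = (block l K.+2).+1 by eexists.
exists j0 => n; rewrite addnC -leq_subLR.
have [jn|jn] := leqP (block l n) j0; first by rewrite (eqP jn).
have [m mE] : exists m, m = (block l n - j0)%N by eexists.
rewrite -mE.
have jm : (j0 + m)%N = block l n by rewrite mE subnKC // ltnW.
have notn (j : 'I_m) : block l n <> (j0 + j)%N.
  by rewrite -jm => /addnI mj; have := ltn_ord j; rewrite -mj ltnn.
pose W j := wave w (phase l w j) b.
(* the positive part of the wave of each of the [m] blocks after the first [j0];
   neighbouring test sequences have supports separated by at least one index *)
pose phi (j : 'I_m) (k : nat) : R :=
  if block l k == (j0 + j)%N then Num.max (W (j0 + j)%N k) 0 else 0.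
have Kblock k : (j0 <= block l k)%N -> (K.+2 < k)%N.
  by rewrite j0E; apply: block_lt.
apply: (Lmatrix_count_ge (phi := phi)) => //.
- by move=> j; rewrite /phi block0 j0E.
- by move=> j; rewrite /phi; case: eqP => // /notn.
move=> c c0; set T := fun k => _; cbv zeta.
have T0 : T 0%N = 0 by rewrite /T big1 // => j _; rewrite /phi block0 j0E mulr0.
have Tn : T n = 0.
  rewrite /T big1 // => j _; rewrite /phi; case: eqP => [/notn //|].
  by rewrite mulr0.
have Tblock (j : 'I_m) k : block l k = (j0 + j)%N -> T k = c 0 j * Num.max (W (j0 + j)%N k) 0.
  move=> E; rewrite /T (bigD1 j) //= big1 ?addr0.
    by rewrite /phi E eqxx.
  by move=> i ij; rewrite /phi E eqn_add2l eq_sym val_eqE (negPf ij) mulr0.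
(* on its block the argument of the wave stays in [[-a, a]], so a positive value
   leaves a margin [a - a'] that keeps the neighbouring indices in the block *)
have Wpos j k : 0 < W j k -> block l k = j ->
    `|w * ln k%:R - phase l w j| < a'.
  rewrite /W /wave pmulr_rgt0 ?expR_gt0 // => h E; rewrite ltNge; apply/negP => h2.
  have h3 : `|w * ln k%:R - phase l w j| <= pi.
    by rewrite -E (le_trans (phase_le l0 k w0)) // -aE.
  have : cos (w * ln k%:R - phase l w j) <= cos a'.
    rewrite -cos_norm leNgt ltr_cos ?in_itv /= ?normr_ge0 ?h3 -?leNgt //.
    apply/andP; split; lra.
  by rewrite /b in h; lra.
(* replacing the wave by its positive part only increases the neighbouring
   values, so the subsolution inequality is preserved *)
have key k : (k < n)%N -> T k.+1 * (2 * T k.+1 - T k - T k.+2) <=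
    (4^-1 + w ^+ 2) * (((k%:R + nu)^-1 - (k.+1%:R + nu)^-1) * T k.+1 ^+ 2)
    ?= iff (T k.+1 == 0).
  move=> kn; apply/leifP; have [->|Tk0] := eqVneq (T k.+1) 0.
    by rewrite expr0n !mulr0 mul0r.
  have [j E] : exists j : 'I_m, block l k.+1 = (j0 + j)%N.
    apply: contraNP Tk0 => nj; rewrite /T big1 // => j _; rewrite /phi.
    by case: eqP => [E|]; [case: nj; exists j|rewrite mulr0].
  have Wk : 0 < W (j0 + j)%N k.+1.
    rewrite ltNge; apply: contra Tk0 => h.
    by rewrite (Tblock j) // max_r // mulr0.
  have Kk : (K.+2 <= k)%N by rewrite -ltnS; apply: Kblock; rewrite E leq_addr.
  have ph := Wpos _ _ Wk E.
  have E0 : block l k = (j0 + j)%N.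
    apply: (phase_block l0 w0); have := step k (phase l w (j0 + j)%N).
    have -> : (K2 <= k)%N by apply: leq_trans (ltnW (ltnW Kk)).
    move=> /(_ isT); rewrite -aE; move: ph; rewrite !ltr_norml => /andP[p1 p2] /andP[p3 p4].
    by apply/andP; split; lra.
  have E2 : block l k.+2 = (j0 + j)%N.
    apply: (phase_block l0 w0); have := step k.+1 (phase l w (j0 + j)%N).
    have -> : (K2 <= k.+1)%N by apply: leq_trans (leqW (ltnW (ltnW Kk))).
    move=> /(_ isT); rewrite -aE; move: ph; rewrite !ltr_norml => /andP[p1 p2] /andP[p3 p4].
    by apply/andP; split; lra.
  have := sub k (phase l w (j0 + j)%N); rewrite -!/(W _ _).
  have -> : (K1 <= k)%N by apply: leq_trans (ltnW (ltnW Kk)).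
  move=> /(_ isT) hsub.
  move: Tk0; rewrite (Tblock _ _ E) (Tblock _ _ E0) (Tblock _ _ E2).
  rewrite (max_l (ltW Wk)) mulf_eq0 negb_or => /andP[cj0 _].
  have m0 : W (j0 + j)%N k <= Num.max (W (j0 + j)%N k) 0 by rewrite le_max lexx.
  have m2 : W (j0 + j)%N k.+2 <= Num.max (W (j0 + j)%N k.+2) 0 by rewrite le_max lexx.
  move: m0 m2 hsub Wk; set X := W _ k.+1; set M0 := Num.max _ _; set M2 := Num.max _ _.
  set X0 := W _ k; set X2 := W _ k.+2; set d := _^-1 - _ => m0 m2 hsub X0p.
  rewrite -subr_gt0.
  have -> : (4^-1 + w ^+ 2) * (d * (c 0 j * X) ^+ 2) -
    c 0 j * X * (2 * (c 0 j * X) - c 0 j * M0 - c 0 j * M2) =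
    c 0 j ^+ 2 * X * ((4^-1 + w ^+ 2) * d * X - (2 * X - M0 - M2)) by ring.
  rewrite mulr_gt0 //; first by rewrite mulr_gt0 // exprn_even_gt0.
  lra.
rewrite ltr_pdivrMl; last by rewrite ltr_pwDl ?sqr_ge0 // invr_gt0.
rewrite summation_by_parts // mulr_sumr.
have [j cj0] : exists j, c 0 j != 0.
  apply/existsP; apply: contraNT c0 => /existsPn h; apply/eqP/rowP => i.
  by rewrite [RHS]mxE; apply/eqP/negPn.
(* an integer next to the centre of the block, where the wave is positive *)
pose x := expR (((j0 + j)%:R + 2^-1) * l).
pose k := Num.truncn x.
have x0 : 0 < x by apply: expR_gt0.
have lnx : w * ln x = phase l w (j0 + j)%N by rewrite /x expRK.
have xk : x < k.+1%:R by apply: truncnS_gt.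
have Kk : (K < k)%N.
  have : (j0 <= block l k.+1)%N.
    rewrite /block truncn_ge_nat ?(divr_ge0 (ln_nat_ge0 _ _) (ltW l0)) // ler_pdivlMr //.
    apply: (@le_trans _ _ (ln x)); last by rewrite ler_ln ?posrE ?ltr0n // ltW.
    rewrite /x expRK natrD ler_pM2r // -addrA lerDl addr_ge0 // invr_ge0 //.
  by move=> /Kblock /ltnW; rewrite !ltnS.
have kx : k%:R <= x by rewrite truncn_le ltW.
have ph : `|w * ln k.+1%:R - phase l w (j0 + j)%N| < a - a'.
  have := step k (phase l w (j0 + j)%N).
  have -> : (K2 <= k)%N by apply: leq_trans (ltnW Kk).
  move=> /(_ isT); apply: le_lt_trans; rewrite -lnx.
  have h1 : w * ln x <= w * ln k.+1%:R.
    by rewrite ler_pM2l // ler_ln ?posrE ?ltr0n // ltW.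
  have h2 : w * ln k%:R <= w * ln x.
    by rewrite ler_pM2l // ler_ln ?posrE ?ltr0n // (leq_ltn_trans _ Kk).
  have h3 := le_trans h2 h1.
  rewrite ger0_norm ?subr_ge0 // ger0_norm; last by lra.
  lra.
have E : block l k.+1 = (j0 + j)%N.
  by apply: (phase_block l0 w0); apply: (lt_trans ph); rewrite -aE; lra.
have kn : (k < n)%N.
  by apply/ltnW/(block_lt l0); rewrite E -jm ltn_add2l.
have Tk : T k.+1 != 0.
  rewrite (Tblock _ _ E) mulf_neq0 // gt_eqF // lt_max; apply/orP; left.
  rewrite /W /wave mulr_gt0 ?expR_gt0 // /b subr_gt0.
  rewrite -(cos_norm (_ - _)) ltr_cos ?in_itv /= ?normr_ge0 /=.
  - by apply: (lt_trans ph); lra.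
  - by apply/ltW/(lt_trans ph); lra.
  - by apply/andP; split; lra.
rewrite [ltLHS](bigD1 (Ordinal kn)) //= [ltRHS](bigD1 (Ordinal kn)) //=.
rewrite ltr_leD //; first by rewrite (lt_leif (key _ kn)).
by apply: ler_sum => i _; apply: (key i (ltn_ord i)).
Qed.

End lower.

(** * Upper bound for the number of eigenvalues *)

Lemma card_le_injection (n M : nat) (S : {set 'I_n}) (g : 'I_n -> nat) :
  {in S &, injective g} -> (forall i, i \in S -> (g i < M)%N) -> (#|S| <= M)%N.
Proof.
move=> ginj gM; rewrite -(size_iota 0 M) cardE -(size_map g).
apply: uniq_leq_size.
  by rewrite map_inj_in_uniq ?enum_uniq // => i j; rewrite !mem_enum; apply: ginj.
by move=> x /mapP[k]; rewrite mem_enum mem_iota /= => /gM gk ->.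
Qed.

(** The local form of the Picone inequality: [p] and [q] are the quotients, in
    both directions, of two consecutive values of a positive sequence. *)
Lemma weighted_square_le (R : realFieldType) (x y p q : R) :
  0 < p -> 0 < q -> p * q = 1 -> x ^+ 2 * (1 - p) + y ^+ 2 * (1 - q) <= (y - x) ^+ 2.
Proof.
move=> p0 q0 pq; rewrite -subr_ge0.
have -> : (y - x) ^+ 2 - (x ^+ 2 * (1 - p) + y ^+ 2 * (1 - q)) = q * (p * x - y) ^+ 2.
  have -> : q * (p * x - y) ^+ 2 = (p * q) * p * x ^+ 2 - 2 * (p * q) * x * y + q * y ^+ 2.
    ring.
  rewrite pq; ring.
by rewrite mulr_ge0 ?sqr_ge0 // ltW.
Qed.

(** The indices [i] counted here are the last one, the first [K + 1] ones, and
    those at which the nondecreasing [B] jumps; a jump is determined by the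
    value of [B] before it. *)
Lemma card_jumps (n K : nat) (B : nat -> nat) :
  {homo B : k k' / (k <= k')%N} ->
  (#|[set i : 'I_n | [|| i.+1 == n, (i <= K)%N | B i.+1 != B i.+2]]%SET| <= B n + K.+2)%N.
Proof.
move=> Bhomo; set Z := [set i | _]%SET.
pose g (i : 'I_n) := if i.+1 == n then 0%N else if (i <= K)%N then i.+1
  else (K.+2 + B i.+1)%N.
have jump (i : 'I_n) : i \in Z -> i.+1 <> n -> (K < i)%N ->
    (B i.+1 < B i.+2)%N.
  rewrite inE => /or3P[/eqP//|h _|h _ _]; first by rewrite ltnNge h.
  by rewrite ltn_neqAle h Bhomo.
apply: (card_le_injection (g := g)) => [i j iZ jZ|i iZ]; rewrite /g.
  have Ji := jump i iZ; have Jj := jump j jZ.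
  have [iE|/eqP ni] := eqVneq i.+1 n; have [jE|/eqP nj] := eqVneq j.+1 n.
  - by move=> _; apply: val_inj => /=; lia.
  - by case: ifP.
  - by case: ifP.
  case: leqP => iK; case: leqP => jK //; [by move=> *; apply: val_inj => /=; lia|lia|lia|].
  move=> /addnI ij; apply: val_inj => /=.
  case: (ltngtP i j) => // h.
    have := Bhomo _ _ (h : (i.+2 <= j.+1)%N); have := Ji ni iK; lia.
  have := Bhomo _ _ (h : (j.+2 <= i.+1)%N); have := Jj nj jK; lia.
case: eqP => [|ni]; first by lia.
case: (leqP i K) => iK; first by lia.
have := jump i iZ ni iK.
have h : (i.+2 <= n)%N by rewrite ltn_neqAle ltn_ord andbT; apply/eqP.
by have := Bhomo _ _ h; lia.
Qed.

Section upper.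
Variables (R : realType) (w nu l : R).
Hypotheses (hnu : forall k : nat, nu != - k%:R).
Hypotheses (w0 : 0 < w) (l0 : 0 < l) (lpi : w * l < pi).

(** At most one eigenvalue above [1 / (1/4 + w^2)] for each block of logarithmic
    length [l < pi / w], up to a bounded number of exceptions. *)
Lemma Lmatrix_eigencount_upper :
  exists C : nat, forall n : nat, (
    eigencount (Lmatrix n nu) (fun mu => ((4^-1 + w ^+ 2)^-1 < mu)%R) <= block l n + C)%N.
Proof.
have pi0 := pi_gt0 R.
have [a [a' [aE ap a'p aa']]] : exists a a', [/\ a = w * l / 2, 0 < a, a' < pi / 2 & a < a'].
  exists (w * l / 2), ((w * l / 2 + pi / 2) / 2).
  have wl : 0 < w * l by rewrite mulr_gt0.
  by move: lpi wl pi0; move: (w * l) (pi : R) => x p *; split => //; lra.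
(* the wave [cos - b] is positive for arguments in [[-a', a']], which contains
   those of a block and of the indices next to it *)
have ca' : 0 < cos a' by apply: cos_gt0_pihalf; apply/andP; split; lra.
pose b := cos a' / 2.
have b0 : 0 < b by rewrite divr_gt0.
have b1 : b <= 1.
  by rewrite /b ler_pdivrMr // mul1r (le_trans (cos_le1 _)) // ler1n.
have bc : b < cos a' by rewrite /b ltr_pdivrMr // mulr_natr mulr2n ltrDl.
have [K1 super] := wave_supersolution nu w0 b0 b1.
have g0 : 0 < a' - a by rewrite subr_gt0.
have [K2 K20 step] := phase_step w0 g0.
have [K [K1K K2K]] : exists K, (K1 <= K)%N /\ (K2 <= K)%N.
  by exists (maxn K1 K2); rewrite leq_maxl leq_maxr.
exists K.+2 => n.
pose Z := [set i : 'I_n | [|| i.+1 == n, (i <= K)%N | block l i.+1 != block l i.+2]]%SET.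
have Zcard : (#|Z| <= block l n + K.+2)%N by apply/card_jumps/block_homo.
apply: leq_trans Zcard; apply: Lmatrix_count_le => //.
  by move=> i /eqP iE; rewrite inE iE.
move=> T T0 TZ.
have Tn : T n = 0.
  case: n @Z TZ => [|n] Z TZ //; apply: (TZ ord_max).
  by rewrite inE eqxx.
(* where [T] does not vanish, the index is large and not at the end of a block *)
have Tnz k : (k < n)%N -> T k.+1 != 0 -> [/\ k.+1 != n, (K < k)%N & block l k.+1 = block l k.+2].
  move=> kn Tk; have : Ordinal kn \notin Z by apply: contraNN Tk => /TZ ->.
  by rewrite inE !negb_or -ltnNge negbK => /and3P[? ? /eqP].
(* the value at [k'] of the wave that is centred on the block of [k] *)
pose W k k' := wave w (phase l w (block l k)) (- b) k'.
have Wpos k k' : `|w * ln k'%:R - phase l w (block l k)| <= a' -> 0 < W k k'.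
  move=> h; rewrite /W /wave mulr_gt0 ?expR_gt0 // subr_gt0 (lt_le_trans bc) //.
  apply: cos_le_of_norm_le => //; lra.
have W0 k : 0 < W k k.
  apply: Wpos; apply: (le_trans (phase_le l0 k w0)); rewrite -aE ltW //.
have W1 k : (K <= k)%N -> 0 < W k k.+1.
  move=> Kk; apply: Wpos; have := phase_le l0 k w0; rewrite -aE.
  have := step k (phase l w (block l k)) (leq_trans K2K Kk).
  rewrite ltr_norml ler_norml => /andP[p1 p2] /andP[p3 p4].
  by rewrite ler_norml; apply/andP; split; lra.
have WN1 k : (K <= k)%N -> 0 < W k.+1 k.
  move=> Kk; apply: Wpos; have := phase_le l0 k.+1 w0; rewrite -aE.
  have := step k (phase l w (block l k.+1)) (leq_trans K2K Kk).
  rewrite ltr_norml ler_norml => /andP[p1 p2] /andP[p3 p4].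
  by rewrite ler_norml; apply/andP; split; lra.
pose p k := W k k.+1 / W k k.
pose q k := W k.+1 k / W k.+1 k.+1.
have lamp : 0 < 4^-1 + w ^+ 2 by rewrite ltr_pwDl ?sqr_ge0 // invr_gt0.
rewrite mulrC ler_pdivlMr // mulrC.
(* if neither value of [T] vanishes, both indices are in the same block and this
   is the Picone inequality; otherwise it only uses that [p] and [q] are positive *)
have pointwise k : (k < n)%N ->
    T k ^+ 2 * (1 - p k) + T k.+1 ^+ 2 * (1 - q k) <= (T k.+1 - T k) ^+ 2.
  move=> kn; have [Tk0|Tk0] := eqVneq (T k) 0.
    rewrite Tk0 expr0n /= mul0r add0r subr0.
    have [->|Tk1] := eqVneq (T k.+1) 0; first by rewrite expr0n mul0r.
    have [_ Kk _] := Tnz k kn Tk1.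
    rewrite ler_piMr ?sqr_ge0 // gerBl divr_ge0 // ltW //; exact: WN1 (ltnW Kk).
  have [k' kE] : exists k', k = k'.+1.
    by case: (k) Tk0 => [|k']; [rewrite T0 eqxx|exists k'].
  have [] := Tnz k' _ _; [by rewrite -kE ltnW|by rewrite -kE|].
  rewrite -kE => _ Kk' blockE.
  have Kk : (K <= k)%N by rewrite kE ltnW // ltnW.
  have [Tk1|Tk1] := eqVneq (T k.+1) 0.
    rewrite Tk1 expr0n /= mul0r addr0 sub0r sqrrN.
    by rewrite ler_piMr ?sqr_ge0 // gerBl divr_ge0 // ltW // W1.
  have bE : block l k.+1 = block l k by rewrite blockE kE.
  apply: weighted_square_le.
  - by rewrite divr_gt0 // W1.
  - by rewrite divr_gt0 // WN1.
  - rewrite /p /q /W bE -!/(W _ _) mulrA divfK ?gt_eqF // divff // gt_eqF // W1 //.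
apply: (@le_trans _ _ (\sum_(k < n) (T k ^+ 2 * (1 - p k) + T k.+1 ^+ 2 * (1 - q k)))); last first.
  by apply: ler_sum => k _; apply: pointwise.
have shift : \sum_(k < n) T k ^+ 2 * (1 - p k) = \sum_(k < n) T k.+1 ^+ 2 * (1 - p k.+1).
  apply/eqP; rewrite -subr_eq0 -sumrB.
  rewrite -(big_mkord xpredT (fun k => T k ^+ 2 * (1 - p k) - T k.+1 ^+ 2 * (1 - p k.+1))).
  rewrite -oppr_eq0 -sumrN.
  rewrite (eq_bigr (fun k => T k.+1 ^+ 2 * (1 - p k.+1) - T k ^+ 2 * (1 - p k))); last first.
    by move=> k _; rewrite opprB.
  by rewrite (telescope_sumr (fun k => T k ^+ 2 * (1 - p k))) // T0 Tn expr0n !mul0r subrr.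
rewrite big_split /= shift -big_split /= mulr_sumr; apply: ler_sum => k _.
have [->|Tk] := eqVneq (T k.+1) 0; first by rewrite expr0n /= !mul0r !mulr0 addr0.
have [_ Kk _] := Tnz k (ltn_ord k) Tk.
rewrite -mulrDr mulrA mulrC ler_pM2l ?exprn_even_gt0 //.
rewrite -(ler_pM2r (W0 k.+1)).
have -> : (1 - p k.+1 + (1 - q k)) * W k.+1 k.+1 = 2 * W k.+1 k.+1 - W k.+1 k - W k.+1 k.+2.
  by rewrite /p /q; field; rewrite gt_eqF.
by apply: ltW; apply: super; rewrite (leq_trans K1K) // ltnW.
Qed.

End upper.

(** * Asymptotics of the eigenvalue counts *)

Lemma eigencount_mono (R : realType) (n : nat) (nu : R) (P Q : pred R) :
  (forall k : nat, nu != - k%:R) -> (forall mu, P mu -> Q mu) ->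
  (eigencount (Lmatrix n nu) P <= eigencount (Lmatrix n nu) Q)%N.
Proof.
move=> hnu PQ; have [E [mu mui [EE EA]]] := Lmatrix_eigenbasis n hnu.
rewrite !(eigencountE _ mui EE EA); apply/subset_leq_card/fintype.subsetP => i.
by rewrite !inE; apply: PQ.
Qed.

Lemma eigencount_sub (R : realType) (n : nat) (nu : R) (P Q S : pred R) :
  (forall k : nat, nu != - k%:R) -> (forall mu, P mu -> Q mu || S mu) ->
  (eigencount (Lmatrix n nu) P <=
   eigencount (Lmatrix n nu) Q + eigencount (Lmatrix n nu) S)%N.
Proof.
move=> hnu PQS; have [E [mu mui [EE EA]]] := Lmatrix_eigenbasis n hnu.
rewrite !(eigencountE _ mui EE EA); apply: leq_trans (leq_card_setU _ _).
apply/subset_leq_card/fintype.subsetP => i.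
by rewrite !inE; apply: PQS.
Qed.

Lemma near_ln_ge (R : realType) (M : R) : \forall n \near \oo, M <= ln (n%:R : R).
Proof.
near=> n.
have h : expR M <= n%:R by near: n; apply: nbhs_infty_ger.
by rewrite -[M]expRK ler_ln ?posrE ?expR_gt0 // (lt_le_trans _ h) ?expR_gt0.
Unshelve. all: by end_near. Qed.

Lemma eigencount_rate_upper (R : realType) (w nu eps : R) :
  (forall k : nat, nu != - k%:R) -> 0 < w -> 0 < eps ->
  \forall n \near \oo,
    (eigencount (Lmatrix n nu) (fun mu => ((4^-1 + w ^+ 2)^-1 < mu)%R))%:R
    <= (w / pi + eps) * ln (n%:R : R).
Proof.
move=> hnu w0 e0; have pi0 := pi_gt0 R.
pose u := w / pi + eps / 2.
have u0 : 0 < u by rewrite addr_gt0 ?divr_gt0.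
have l0 : 0 < u^-1 by rewrite invr_gt0.
have lpi : w * u^-1 < pi.
  by rewrite ltr_pdivrMr // mulrDr mulrCA divff ?gt_eqF // mulr1 ltrDl mulr_gt0 // divr_gt0.
have [C hC] := Lmatrix_eigencount_upper hnu w0 l0 lpi.
near=> n.
have hn : C%:R / (eps / 2) <= ln (n%:R : R) by near: n; apply: near_ln_ge.
rewrite ler_pdivrMr ?divr_gt0 // in hn.
have : (eigencount (Lmatrix n nu) (fun mu => ((4^-1 + w ^+ 2)^-1 < mu)%R))%:R
    <= (block u^-1 n)%:R + C%:R :> R by rewrite -natrD ler_nat.
move=> /le_trans; apply.
have : (block u^-1 n)%:R <= ln (n%:R : R) * u.
  by rewrite -[X in _ * X]invrK truncn_le divr_ge0 ?ln_nat_ge0 // ltW.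
move=> h; apply: (le_trans (lerD h hn)).
by rewrite /u -mulrDr -addrA -splitr mulrC.
Unshelve. all: by end_near. Qed.

Lemma eigencount_rate_lower (R : realType) (w nu eps : R) :
  (forall k : nat, nu != - k%:R) -> 0 < w -> 0 < eps ->
  \forall n \near \oo,
    (w / pi - eps) * ln (n%:R : R) <=
    (eigencount (Lmatrix n nu) (fun mu => ((4^-1 + w ^+ 2)^-1 < mu)%R))%:R.
Proof.
move=> hnu w0 e0; have pi0 := pi_gt0 R.
have v0 : 0 < w / pi by rewrite divr_gt0.
(* the blocks have length [1 / (w / pi - d)], at most [2 pi / w] *)
have [d [d0 de dv]] : exists d, [/\ 0 < d, d <= eps / 2 & d <= (w / pi) / 2].
  exists (Num.min (eps / 2) ((w / pi) / 2)).
  by rewrite lt_min !ge_min !lexx orbT !divr_gt0.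
pose u := w / pi - d.
have u2 : (w / pi) / 2 <= u by rewrite /u; lra.
have u0 : 0 < u by apply: lt_le_trans u2; rewrite divr_gt0.
have wE : w = (w / pi) * pi by rewrite divfK // gt_eqF.
have lpi : pi < w * u^-1.
  rewrite ltr_pdivlMr // [ltRHS]wE mulrC ltr_pM2r // /u; lra.
have l2pi : w * u^-1 <= 2 * pi.
  rewrite ler_pdivrMr // [leLHS]wE [leRHS]mulrAC ler_pM2r //; lra.
have [C hC] := Lmatrix_eigencount_lower hnu w0 lpi l2pi.
near=> n.
have hn : C.+1%:R / (eps / 2) <= ln (n%:R : R) by near: n; apply: near_ln_ge.
rewrite ler_pdivrMr ?divr_gt0 // -natr1 in hn.
have := hC n; rewrite -(ler_nat R) natrD; set N := (eigencount _ _)%:R => h1.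
have : ln (n%:R : R) * u < (block u^-1 n)%:R + 1.
  by rewrite -[X in _ * X]invrK natr1 truncnS_gt.
have L0 := ln_nat_ge0 R n; move: L0 hn h1; set L := ln _; set B := (block _ _)%:R.
move=> L0 hn h1 h2.
have : L * (eps / 2 - d) >= 0 by rewrite mulr_ge0 // subr_ge0.
rewrite /u in h2; move: h2 hn h1; set v := w / pi; lra.
Unshelve. all: by end_near. Qed.

Theorem theorem1 (R : realType) (nu x : R)
    (hnu : forall k : nat, nu != - k%:R) (hx0 : 0 < x) (hx1 : x < 1) :
  (fun n : nat =>
     #|` fset_set [set mu | spectrum (Lmatrix n nu) mu /\ 4 * x < mu < 4]|%:R
       / ln n%:R : R) @ \oo
    --> (2 * pi)^-1 * Num.sqrt ((1 - x) / x).
Proof.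
have pi0 := pi_gt0 R.
pose w := Num.sqrt ((1 - x) / x) / 2.
have q0 : 0 < (1 - x) / x by rewrite divr_gt0 // subr_gt0.
have w0 : 0 < w by rewrite divr_gt0 // sqrtr_gt0.
have wx : (4^-1 + w ^+ 2)^-1 = 4 * x.
  have -> : 4^-1 + w ^+ 2 = (4 * x)^-1.
    rewrite /w expr_div_n sqr_sqrtr ?ltW //; field; by rewrite gt_eqF.
  by rewrite invrK.
have -> : (2 * pi)^-1 * Num.sqrt ((1 - x) / x) = w / pi.
  by rewrite /w invfM mulrC mulrA.
apply/cvgrPdist_le => eps eps0.
have e2 : 0 < eps / 2 by rewrite divr_gt0.
(* the eigenvalues from [4] on are counted with the small frequency [w'] *)
pose w' := pi * (eps / 4).
have w'0 : 0 < w' by rewrite mulr_gt0 // divr_gt0.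
have w'pi : w' / pi = eps / 4 by rewrite /w' mulrC mulKf // gt_eqF.
have w'4 : (4^-1 + w' ^+ 2)^-1 < 4.
  by rewrite invf_plt ?posrE // ?ltrDl ?exprn_gt0 // addr_gt0 // exprn_gt0.
have e4 : 0 < eps / 4 by rewrite divr_gt0.
near=> n.
have up : (eigencount (Lmatrix n nu) (fun mu => ((4^-1 + w ^+ 2)^-1 < mu)%R))%:R
    <= (w / pi + eps / 2) * ln (n%:R : R) by near: n; apply: eigencount_rate_upper.
have lo : (w / pi - eps / 2) * ln (n%:R : R) <=
    (eigencount (Lmatrix n nu) (fun mu => ((4^-1 + w ^+ 2)^-1 < mu)%R))%:R.
  by near: n; apply: eigencount_rate_lower.
have up' : (eigencount (Lmatrix n nu) (fun mu => ((4^-1 + w' ^+ 2)^-1 < mu)%R))%:R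
    <= (w' / pi + eps / 4) * ln (n%:R : R) by near: n; apply: eigencount_rate_upper.
have L1 : 1 <= ln (n%:R : R) by near: n; apply: near_ln_ge.
rewrite wx in up lo; rewrite w'pi in up'.
rewrite -/(eigencount (Lmatrix n nu) (fun mu => 4 * x < mu < 4)).
have h1 : (eigencount (Lmatrix n nu) (fun mu => 4 * x < mu < 4)%R
    <= eigencount (Lmatrix n nu) (fun mu => 4 * x < mu)%R)%N.
  by apply: eigencount_mono => // mu /andP[].
have h2 : (eigencount (Lmatrix n nu) (fun mu => 4 * x < mu)%R
    <= eigencount (Lmatrix n nu) (fun mu => 4 * x < mu < 4)%R
       + eigencount (Lmatrix n nu) (fun mu => (4^-1 + w' ^+ 2)^-1 < mu)%R)%N.
  apply: eigencount_sub => // mu /= ->; case: ltP => //= mu4.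
  exact: lt_le_trans mu4.
rewrite -(ler_nat R) in h1; rewrite -(ler_nat R) natrD in h2.
move: up lo up' L1 h1 h2; set L := ln _; set N := (eigencount _ (fun mu => 4 * x < mu < 4))%:R.
set N1 := (eigencount _ (fun mu => 4 * x < mu))%:R.
set N2 := (eigencount _ (fun mu => (4^-1 + w' ^+ 2)^-1 < mu))%:R.
move=> up lo up' L1 h1 h2; have L0 : 0 < L by apply: lt_le_trans L1.
have -> : w / pi - N / L = (w / pi * L - N) / L by rewrite mulrBl mulfK // gt_eqF.
rewrite normrM normfV (gtr0_norm L0) ler_pdivrMr // ler_norml.
by apply/andP; split; lra.
Unshelve. all: by end_near. Qed.
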